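(* Let $\mathcal{X}$ be a finite set, $P_X$ a probability distribution on $\mathcal{X}$, $\rho>0$, and for each $n$ let $\mathbf{X}_n=(X_1,\dots,X_n)$ be i.i.d. with law $P_X$. Let $\mathcal{A}$ be a nonempty countable (possibly infinite) set of agents. A strategy consists of, for each agent $a\in\mathcal{A}$, a (possibly random) sequence of guesses $\{\hat{\mathbf{X}}^{(a)}_k: k\ge 1\}$ with values in $\mathcal{X}^n$, independent of $\mathbf{X}_n$ (but allowed to depend on $P_X$), the sequences being independent over $a\in\mathcal{A}$. Let $\Pi$ be the set of all bijections $\pi:\mathbb{N}^+\to\mathcal{A}\times\mathbb{N}^+$; for $\pi\in\Pi$ with $\pi(i)=(a_i,k_i)$, write $\pi(\hat{\mathbf{X}}_1^\infty)$ for the sequence $\{\hat{\mathbf{X}}^{(a_i)}_{k_i}: i\ge1\}$ and $$G(\mathbf{X}_n,\pi(\hat{\mathbf{X}}_1^\infty))=\inf\{i\ge1:\hat{\mathbf{X}}^{(a_i)}_{k_i}=\mathbf{X}_n\}.$$ Let $G^*(\mathbf{X}_n)$ denote the position of $\mathbf{X}_n$ in a list of all elements of $\mathcal{X}^n$ sorted in decreasing order of their probability under the product distribution $P_X^{\otimes n}$ (ties broken arbitrarily). Then $$\lim_{n\to\infty}\frac1n\log\Big(\inf_{\text{strategies}}\ \sup_{\pi\in\Pi}\ \mathbb{E}\big[G(\mathbf{X}_n,\pi(\hat{\mathbf{X}}_1^\infty))^\rho\big]\Big)=\lim_{n\to\infty}\frac1n\log\mathbb{E}\big[G^*(\mathbf{X}_n)^\rho\big]=\rho\,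 H_{\frac{1}{1+\rho}}(X),$$ where $X\sim P_X$.
   Context: Logarithms are natural. For $\alpha>0$, $\alpha\neq1$, the Rényi entropy of order $\alpha$ of $X\sim P_X$ is $H_\alpha(X)=\frac{1}{1-\alpha}\log\sum_{x\in\mathcal{X}}P_X(x)^\alpha$. The expectation is over $\mathbf{X}_n$ and the randomness of the guesses. The infimum is over all strategies as described. *)

(* Defs.v *)
From HB Require Import structures.
From mathcomp Require Import all_boot all_order all_algebra.
From mathcomp Require Import all_classical all_reals all_analysis.
Unset Printing Implicit Defensive.
Import Order.TTheory GRing.Theory Num.Theory.
Local Open Scope classical_set_scope.
Local Open Scope ring_scope.

Section Defs.
Context {R : realType} {T : finType}.

Definition is_pmf (P : T -> R) : Prop :=
  (forall x, 0 <= P x) /\ \sum_(x : T) P x = 1.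

Definition renyi_entropy (alpha : R) (P : T -> R) : R :=
  (1 - alpha)^-1 * ln (\sum_(x : T) P x `^ alpha).

Definition prod_pmf (P : T -> R) (n : nat) (x : {ffun 'I_n -> T}) : R :=
  \prod_(i < n) P (x i).

(* G(x, s) = inf { i >= 1 : s_i = x }, with s indexed from 0 (s i is the
   (i+1)-th guess); inf of the empty set is +oo. *)
Definition guesswork {V : Type} (x : V) (s : nat -> V) : \bar R :=
  ereal_inf [set ((i.+1)%:R)%:E | i in [set i | s i = x]].

(* a ranking (0-based positions) of X^n in decreasing order of probability,
   ties broken arbitrarily: a bijection onto {0,..,|X|^n - 1} such that
   more probable sequences come first. G*(x) = r x + 1. *)
Definition is_sorted_ranking (P : T -> R) (n : nat)
    (r : {ffun 'I_n -> T} -> nat) : Prop :=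
  injective r /\ (forall x, (r x < #|T| ^ n)%N) /\
  (forall x y, prod_pmf P n y < prod_pmf P n x -> (r x < r y)%N).

Definition opt_moment (P : T -> R) (rho : R) (n : nat)
    (r : {ffun 'I_n -> T} -> nat) : R :=
  \sum_(x : {ffun 'I_n -> T}) prod_pmf P n x * ((r x).+1%:R `^ rho).

End Defs.

Section Strategies.
Context {R : realType} {d : measure_display} {Omega : measurableType d}.
Context {A : countType} {V : Type}.

Definition guesses_measurable (g : A -> nat -> Omega -> V) : Prop :=
  forall a k v, measurable (g a k @^-1` [set v]).

Definition agent_sigma (ga : nat -> Omega -> V) : set (set Omega) :=
  <<s [set E | exists k v, E = ga k @^-1` [set v]] >>.

Definition agents_independent (Pr : probability Omega R)
    (g : A -> nat -> Omega -> V) : Prop :=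
  forall (F : seq A) (E : A -> set Omega), uniq F ->
    (forall a, a \in F -> agent_sigma (g a) (E a)) ->
    Pr (\big[setI/setT]_(a <- F) E a) = (\prod_(a <- F) Pr (E a))%E.
End Strategies.

(* E[ G(X_n, pi(Xhat))^rho ] where X_n ~ P^{\otimes n} is independent of the
   guesses (so the expectation over X_n is the outer finite sum) *)
Definition strategy_moment {R : realType} {T : finType} {A : countType}
    {d : measure_display} {Omega : measurableType d}
    (P : T -> R) (rho : R) (n : nat) (Pr : probability Omega R)
    (g : A -> nat -> Omega -> {ffun 'I_n -> T}) (pi : nat -> A * nat) : \bar R :=
  (\sum_(x : {ffun 'I_n -> T})
     (prod_pmf P n x)%:E *
     \int[Pr]_(w in setT)
        poweR (guesswork x (fun i => g (pi i).1 (pi i).2 w)) rho)%E.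

Definition optimal_value {R : realType} {T : finType} (A : countType)
    (P : T -> R) (rho : R) (n : nat) : \bar R :=
  ereal_inf [set v | exists (d : measure_display) (Omega : measurableType d)
     (Pr : probability Omega R) (g : A -> nat -> Omega -> {ffun 'I_n -> T}),
     guesses_measurable g /\ agents_independent Pr g /\
     v = ereal_sup [set strategy_moment P rho n Pr g pi |
                      pi in [set pi : nat -> A * nat | bijective pi]]].

(* Main.v *)
(** Put S = sum_x P(x)^(1/(1+rho)) over the words x of length n; S is the n-th
power of the one-letter sum, and rho H_{1/(1+rho)} = (1 + rho) log S / n.

Lower bound (Arikan): whatever the sequence of guesses, the guessing times of
distinct words are distinct positive integers (or infinite), so the sum of their
inverses over the N = |X|^n words is at most L = 2 + log N. By convexity of
t |-> t^(-rho), sum_x P(x) G(x)^rho >= S^(1+rho) L^(-rho), and L is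
subexponential in n. This holds for every realization of the guesses and every
interleaving, hence in expectation, and it also applies to the optimal list.

Upper bound: all agents draw i.i.d. guesses from Q = P^(1/(1+rho)) / S. Under
any interleaving G(x) is geometric with parameter Q(x), whose rho-th moment is
at most C Q(x)^(-rho) with C depending only on rho, and
sum_x P(x) Q(x)^(-rho) = S^(1+rho). For the optimal list, the rank of x is at
most the number of y with P(y) >= P(x), hence at most 1/Q(x). *)
Require Import Defs.
From HB Require Import structures.
From mathcomp Require Import all_boot all_order all_algebra.
From mathcomp Require Import all_classical all_reals all_analysis.
From mathcomp Require Import measurable_realfun ring lra.
Import Order.TTheory GRing.Theory Num.Theory numFieldNormedType.Exports.
Local Open Scope classical_set_scope.
Local Open Scope ring_scope.

(** * Arikan's lower bound for guessing moments *)

Lemma powR_opp (R : realType) (x a : R) : 0 <= x -> x `^ (- a) = x^-1 `^ a.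
Proof. by move=> x0; rewrite -(powR_inv1 x0) -powRrM mulN1r. Qed.

(** Induction: [ln (1 + t) <= t] at [t = - 1/(N+2)] gives [1/(N+2) <= ln (N+2) - ln (N+1)]. The
    empty sum relies on [ln 0 = 0]. *)
Lemma sum_harmonic_le (R : realType) (N : nat) :
  \sum_(i < N) (i.+1%:R : R)^-1 <= 1 + ln N%:R.
Proof.
elim: N => [|[|N] IH]; first by rewrite big_ord0 ln0 // addr0.
  by rewrite big_ord1 ln1 addr0 invr1.
rewrite big_ord_recr /=; apply: (le_trans (lerD IH (lexx _))).
have Np : (0 : R) < N.+1%:R by rewrite ltr0n.
have Np1 : (0 : R) < N.+2%:R by rewrite ltr0n.
have := @le_ln1Dx R (- N.+2%:R^-1).
have -> : 1 - N.+2%:R^-1 = N.+1%:R / N.+2%:R :> R.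
  rewrite -[X in X - _](divff (lt0r_neq0 Np1)) -[X in _ - X]mul1r -mulrBl.
  by rewrite -[N.+2%:R]natr1 addrK.
rewrite ln_div ?posrE // => H.
have /H {}H : (-1 : R) < - N.+2%:R^-1 by rewrite ltrN2 invf_lt1 // ltr1n.
by rewrite -addrA lerD2l -lerBrDl -lerN2 opprB.
Qed.

(** Each position [i < N] is charged only to the word [s i], which costs at most a harmonic sum. The
    words placed at [N] or later pay at most [1/N] each, hence at most 1 together. The position of a
    word need not be its first one. *)
Lemma sum_inv_position_le (R : realType) (V : finType) (s : nat -> V)
    (h : V -> R) :
  (forall x, h x = 0 \/ exists i, s i = x /\ h x = (i.+1%:R)^-1) ->
  \sum_x h x <= 2 + ln #|V|%:R.
Proof.
move=> hs; set N := #|V|.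
have N0 : (0 < N)%N by apply/card_gt0P; exists (s 0).
apply: (@le_trans _ _ (\sum_x (\sum_(i < N) (s i == x)%:R * (i.+1%:R)^-1
    + N%:R^-1))).
  apply: ler_sum => x _.
  have S0 : (0 : R) <= \sum_(i < N) (s i == x)%:R * (i.+1%:R)^-1.
    by apply: sumr_ge0 => i _; rewrite mulr_ge0 // invr_ge0.
  case: (hs x) => [->|[i [six ->]]]; first by rewrite addr_ge0 // invr_ge0.
  case: (ltnP i N) => iN.
    rewrite ler_wpDr ?invr_ge0 // (bigD1 (Ordinal iN)) //= six eqxx mul1r.
    by rewrite ler_wpDr // sumr_ge0 // => j _; rewrite mulr_ge0 // invr_ge0.
  by rewrite ler_wpDl // lef_pV2 ?posrE ?ltr0n // ler_nat ltnW.
rewrite big_split /= exchange_big /= sumr_const -[_ *+ _]mulr_natr.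
rewrite mulVf ?pnatr_eq0 -?lt0n // addrC.
have -> : (2 : R) = 1 + 1 by [].
rewrite -addrA lerD2l; apply: le_trans (sum_harmonic_le R N).
apply: ler_sum => i _; rewrite -mulr_suml (bigD1 (s i)) //= eqxx big1.
  by rewrite addr0 mul1r.
by move=> x /negPf; rewrite eq_sym => ->.
Qed.

(* The tangent line of the convex function [t |-> t `^ (- rho)] at [t = L],
   evaluated at [t = 1 / (q G)]. *)
Lemma guess_tangent (R : realType) (rho S L p G : R) :
  0 < rho -> 0 < S -> 0 < L -> 0 <= p -> 0 < G ->
  S `^ (1 + rho) * L `^ (- rho) *
    (p `^ (1 + rho)^-1 / S - rho * (G^-1 / L - p `^ (1 + rho)^-1 / S))
  <= p * G `^ rho.
Proof.
move=> r0 S0 L0 p0 G0.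
have K0 : 0 < S `^ (1 + rho) * L `^ (- rho) by rewrite mulr_gt0 // powR_gt0.
have [pe|pn0] := eqVneq p 0.
  rewrite pe powR0; last by rewrite invr_eq0; lra.
  rewrite !mul0r !subr0 sub0r mulrN oppr_le0 mulr_ge0 ?(ltW K0) //.
  by rewrite mulr_ge0 ?(ltW r0)// mulr_ge0 ?invr_ge0 ?ltW.
have {}p0 : 0 < p by rewrite lt_neqAle eq_sym pn0.
(* Since [p = (S q)^(1 + rho)], setting [y = G q L] and cancelling common factors leaves
   [1 + rho (1 - 1/y) <= y^rho], which follows from [ln (1/y) <= 1/y - 1] and [1 + t <= exp t]. *)
set q := p `^ _ / S.
have q0 : 0 < q by rewrite divr_gt0 // powR_gt0.
have pE : p = S `^ (1 + rho) * q `^ (1 + rho).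
  rewrite -powRM ?(ltW S0) ?(ltW q0) // /q mulrC divfK ?gt_eqF //.
  by rewrite -powRrM mulVf ?powRr1 ?(ltW p0) //; lra.
clearbody q.
have y0 : 0 < G * q * L by rewrite !mulr_gt0.
have -> : p * G `^ rho =
    S `^ (1 + rho) * L `^ (- rho) * (q * (G * q * L) `^ rho).
  rewrite {1}pE !powRM ?mulr_ge0 ?(ltW G0) ?(ltW q0) ?(ltW L0) //.
  rewrite [q `^ (1 + rho)]powRD; last by rewrite (gt_eqF q0) implybT.
  rewrite powRr1 ?(ltW q0) // powRN.
  have : L `^ rho != 0 by rewrite gt_eqF // powR_gt0.
  move: (L `^ rho) (S `^ _) (q `^ rho) (G `^ rho) => a b c e a0.
  by field.
rewrite ler_pM2l //.
have H : 1 + rho * (1 - (G * q * L)^-1) <= (G * q * L) `^ rho.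
  have yi : 0 < (G * q * L)^-1 by rewrite invr_gt0.
  have := @le_ln1Dx R ((G * q * L)^-1 - 1).
  rewrite [1 + _]addrC subrK lnV ?posrE // => lny.
  have {}lny : - ln (G * q * L) <= (G * q * L)^-1 - 1 by apply: lny; lra.
  apply: le_trans (_ : 1 + rho * ln (G * q * L) <= _).
    by rewrite lerD2l ler_pM2l //; lra.
  by rewrite /powR gt_eqF // expR_ge1Dx.
rewrite [leLHS](_ : _ = q * (1 + rho * (1 - (G * q * L)^-1))).
  by rewrite ler_pM2l.
by field; rewrite !gt_eqF.
Qed.

(* [P x * G x ^ rho] may be infinite, and [h x] stands for [1 / G x]. *)
Lemma guess_moment_ge (R : realType) (V : finType) (rho L : R) (P h : V -> R)
    (m : V -> \bar R) :
  0 < rho -> 0 < L -> (forall x, 0 <= P x) ->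
  let S := \sum_x P x `^ (1 + rho)^-1 in
  0 < S -> \sum_x h x <= L -> (forall x, 0 <= h x) ->
  (forall x, m x = ((h x)^-1 `^ rho)%:E /\ 0 < h x \/ m x = +oo%E /\ h x = 0) ->
  ((S `^ (1 + rho) * L `^ (- rho))%:E <= \sum_x (P x)%:E * m x)%E.
Proof.
move=> r0 L0 P0 S S0 hL h0 hm; set K := S `^ _ * _.
have K0 : 0 < K by rewrite mulr_gt0 // powR_gt0.
apply: (@le_trans _ _ (\sum_x (K * (P x `^ (1 + rho)^-1 / S
    - rho * (h x / L - P x `^ (1 + rho)^-1 / S)))%:E)%E).
  (* The tangent lines sum to at least [K]: the weights [P x ^ (1/(1+rho)) / S] sum to 1, and the
     [h x / L] to at most 1. *)
  rewrite sumEFin lee_fin -mulr_sumr ler_pMr // sumrB -mulr_suml -/S divff ?gt_eqF //.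
  rewrite -mulr_sumr sumrB -!mulr_suml -/S divff ?gt_eqF //.
  by rewrite lerBrDr gerDl pmulr_rle0 // subr_le0 ler_pdivrMr // mul1r.
apply: lee_sum => x _; case: (hm x) => [] [mE hx].
  rewrite mE -EFinM lee_fin -[X in X / L](invrK (h x)).
  by apply: guess_tangent => //; rewrite invr_gt0.
have [Pe|Pn0] := eqVneq (P x) 0.
  rewrite Pe powR0; last by rewrite invr_eq0 gt_eqF // addr_gt0.
  by rewrite mE hx !mul0r subr0 mulr0 subr0 mulr0 mul0e.
by rewrite mE gt0_muley ?leey // lte_fin lt_neqAle eq_sym Pn0 P0.
Qed.

(** * From two-sided bounds to the exponential rate *)

(** Squeezed between 0 and a multiple of [1 / sqrt n], by [ln y <= 2 sqrt y] and
    [sqrt (2 + n c) <= (2 + c) sqrt n] for [n >= 1]. *)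
Lemma ln_affine_over_n_cvg0 (R : realType) (c : R) : 0 <= c ->
  (fun n : nat => (n%:R)^-1 * ln (2 + n%:R * c)) @ \oo --> (0 : R).
Proof.
move=> c0.
have nP n : 0 < 2 + n%:R * c by rewrite ltr_wpDr // mulr_ge0.
have lim1 : (fun n : nat => (2 + c) * 2 / Num.sqrt n%:R) @ \oo --> (0 : R).
  rewrite -[X in _ --> X](mulr0 ((2 + c) * 2)); apply: cvgMr.
  apply/gtr0_cvgV0.
    by exists 1%N => // n /= n0; rewrite sqrtr_gt0 ltr0n.
  apply/cvgryPge => M; near=> n.
  have [M0|M0] := leP M 0; first by rewrite (le_trans M0) // sqrtr_ge0.
  rewrite -[M](ger0_norm (ltW M0)) -sqrtr_sqr ler_sqrt //.
  by near: n; exact: nbhs_infty_ger.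
apply: (squeeze_cvgr _ (cvg_cst 0) lim1); near=> n.
have n0 : (0 < n)%N by near: n; exists 1%N.
have nr : (0 : R) < n%:R by rewrite ltr0n.
have n1 : (1 : R) <= n%:R by rewrite ler1n.
apply/andP; split.
  rewrite mulr_ge0 ?invr_ge0 // ln_ge0 //.
  by have := @mulr_ge0 R n%:R c (ltW nr) c0; lra.
set y := 2 + n%:R * c.
have y0 : 0 < y by exact: nP.
have sn : 0 < Num.sqrt (n%:R : R) by rewrite sqrtr_gt0.
have nE : n%:R = Num.sqrt n%:R * Num.sqrt n%:R :> R.
  by rewrite -expr2 sqr_sqrtr // ltW.
have lny : ln y <= 2 * Num.sqrt y.
  have sy : 0 < Num.sqrt y by rewrite sqrtr_gt0.
  have -> : y = Num.sqrt y ^+ 2 by rewrite sqr_sqrtr // ltW.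
  rewrite lnXn // sqrtr_sqr ger0_norm ?(ltW sy)// -[ln _ *+ _]mulr_natl.
  by rewrite ler_pM2l // ltW // ln_sublinear.
have yle : Num.sqrt y <= (2 + c) * Num.sqrt n%:R.
  rewrite -[leRHS]ger0_norm; last by rewrite mulr_ge0 ?sqrtr_ge0 // addr_ge0.
  rewrite -sqrtr_sqr ler_sqrt; last by rewrite sqr_ge0.
  rewrite exprMn sqr_sqrtr ?(ltW nr)// /y.
  have : 0 <= (n%:R - 1) * 2 :> R by rewrite mulr_ge0 // subr_ge0.
  have : 0 <= n%:R * c by rewrite mulr_ge0 // ltW.
  have : 0 <= n%:R * (c * c) by rewrite !mulr_ge0 // ltW.
  rewrite expr2; nra.
rewrite mulrC ler_pdivrMr //.
apply: le_trans lny _; apply: le_trans (_ : 2 * ((2 + c) * Num.sqrt n%:R) <= _).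
  by rewrite ler_pM2l.
rewrite [X in _ <= _ * X]nE.
by rewrite [leRHS]mulrA divfK ?gt_eqF // mulrCA mulrA.
Unshelve. all: by end_near.
Qed.

(** After taking logarithms and dividing by [n], the factor [(2 + n c)^(- rho)] and the constant [C]
    both vanish in the limit. Serves the optimal strategy and the optimal list alike. *)
Lemma exponent_cvg (R : realType) (rho s c C : R) (v : nat -> R) :
  0 < rho -> 0 < s -> 0 <= c ->
  (forall n, (s ^+ n) `^ (1 + rho) * (2 + n%:R * c) `^ (- rho) <= v n
             <= C * (s ^+ n) `^ (1 + rho)) ->
  (fun n : nat => (n%:R)^-1 * ln (v n)) @ \oo --> (1 + rho) * ln s.
Proof.
move=> r0 s0 c0 hv.
have nP n : 0 < 2 + n%:R * c by rewrite ltr_wpDr // mulr_ge0.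
have sP n : 0 < (s ^+ n) `^ (1 + rho) by rewrite powR_gt0 // exprn_gt0.
(* Comparing the two bounds at [n = 0] forces [C] to be positive. *)
have C0 : 0 < C.
  have /andP[h1 h2] := hv 0; have := le_trans h1 h2.
  rewrite mulrC ler_pM2r //; apply: lt_le_trans; exact: powR_gt0.
have lnS n : ln ((s ^+ n) `^ (1 + rho)) = n%:R * ((1 + rho) * ln s).
  by rewrite ln_powR lnXn // -[ln s *+ n]mulr_natl mulrCA.
have lim1 : (fun n : nat => (1 + rho) * ln s
    - rho * ((n%:R)^-1 * ln (2 + n%:R * c))) @ \oo --> (1 + rho) * ln s.
  rewrite -[X in _ --> X](subr0) -[X in _ - X](mulr0 rho).
  by apply: cvgB; [exact: cvg_cst|apply: cvgMr; exact: ln_affine_over_n_cvg0].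
have lim2 : (fun n : nat => (n%:R)^-1 * ln C + (1 + rho) * ln s) @ \oo
    --> (1 + rho) * ln s.
  rewrite -[X in _ --> X]add0r -[X in _ --> X + _](mul0r (ln C)).
  apply: cvgD; last exact: cvg_cst.
  apply: cvgMl; apply/gtr0_cvgV0; first by exists 1%N => // n /= n0; rewrite ltr0n.
  exact: cvgr_idn.
apply: (squeeze_cvgr _ lim1 lim2); near=> n.
have n0 : (0 < n)%N by near: n; exists 1%N.
have nr : (0 : R) < n%:R by rewrite ltr0n.
have /andP[h1 h2] := hv n.
have v0 : 0 < v n by apply: lt_le_trans h1; rewrite mulr_gt0 // powR_gt0.
apply/andP; split.
  rewrite -(ler_pM2l nr) mulVKf ?gt_eqF // mulrBr [_ * (rho * _)]mulrCA mulVKf ?gt_eqF //.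
  have w0 : 0 < (2 + n%:R * c) `^ (- rho) by exact: powR_gt0.
  rewrite -lnS -mulNr -ln_powR -lnM ?posrE //.
  by rewrite ler_ln ?posrE // mulr_gt0.
rewrite -(ler_pM2l nr) mulVKf ?gt_eqF // mulrDr mulVKf ?gt_eqF //.
by rewrite -lnS -lnM ?posrE // ler_ln ?posrE // mulr_gt0.
Unshelve. all: by end_near.
Qed.

(** * An i.i.d. sequence from the digits of a uniform real number *)

(** The image of the Lebesgue measure under [u |-> (u - c) / q], scaled by [1/q], gives half-open
    intervals their length, so it is the Lebesgue measure by uniqueness. *)
Lemma lebesgue_measure_affine (R : realType) (c q : R) (A : set R) :
  0 < q -> measurable A ->
  measurable [set u : R | A ((u - c) / q)] /\
  lebesgue_measure [set u : R | A ((u - c) / q)]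
    = (q%:E * lebesgue_measure A)%E.
Proof.
move=> q0 mA.
pose f (u : measurableTypeR R) : measurableTypeR R := (u - c) / q.
have mf : measurable_fun setT f.
  by apply: measurable_funM => //; exact: measurable_funB.
split; first by rewrite -[X in measurable X]setTI; exact: mf.
have qi0 : 0 <= q^-1 by rewrite invr_ge0 ltW.
pose m : {measure set (measurableTypeR R) -> \bar R} :=
  mscale (NngNum qi0)
    (measure_function_pushforward__canonical__measure_function_Measure
       lebesgue_measure mf).
have -> : lebesgue_measure A = m A.
  apply: lebesgue_measure_unique => //= _ [[a b]] _ <-.
  rewrite /m /mscale /= /pushforward.
  have -> : f @^-1` `]a, b] = `](c + q * a), (c + q * b)]%classic.
    apply/seteqP; split => u /=; rewrite !in_itv /= /f ltr_pdivlMr // ler_pdivrMr //;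
    rewrite ltrBrDl lerBlDl -![q * _]mulrC; exact.
  rewrite !lebesgue_measure_itv /= !lte_fin ltrD2l ltr_pM2l //.
  case: ifPn => _; last by rewrite mule0.
  rewrite -!EFinB -EFinM; congr EFin.
  by field; rewrite gt_eqF.
by rewrite /m /mscale /= muleA -EFinM divff ?gt_eqF // mul1e.
Qed.

Section RandomDigits.
Context {R : realType} {V : finType} (Q : V -> R).
Hypotheses (Q0 : forall v, 0 <= Q v) (Q1 : \sum_v Q v = 1).

Let cum k := \sum_(v : V | (enum_rank v < k)%N) Q v.

Let cumS v : cum (enum_rank v).+1 = cum (enum_rank v) + Q v.
Proof.
rewrite /cum (bigD1 v) //= addrC; congr (_ + _); apply: eq_bigl => w.
rewrite ltnS [RHS]ltn_neqAle andbC; congr (_ && _).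
by rewrite (inj_eq val_inj) (inj_eq enum_rank_inj).
Qed.

Let cum_le k l : (k <= l)%N -> cum k <= cum l.
Proof.
move=> kl; rewrite /cum [leRHS](bigID (fun v => (enum_rank v < k)%N)) /=.
rewrite [X in _ <= X + _](eq_bigl (fun v => (enum_rank v < k)%N)); last first.
  by move=> v /=; rewrite andb_idl // => vk; exact: leq_trans kl.
by rewrite lerDl sumr_ge0.
Qed.

Let cell v (u : R) := cum (enum_rank v) <= u < cum (enum_rank v) + Q v.

Let cellE v u :
  0 < Q v -> (0 <= (u - cum (enum_rank v)) / Q v < 1) = cell v u.
Proof.
move=> qv.
by rewrite pmulr_lge0 ?invr_gt0 // ltr_pdivrMr // mul1r ltrBlDl subr_ge0.
Qed.

Let cell_uniq u v w : cell v u -> cell w u -> v = w.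
Proof.
rewrite /cell -!cumS => /andP[v1 v2] /andP[w1 w2].
apply: enum_rank_inj; apply: val_inj => /=.
case: (ltngtP (enum_rank v) (enum_rank w)) => // /cum_le H.
  by have := lt_le_trans v2 (le_trans H w1); rewrite ltxx.
by have := lt_le_trans w2 (le_trans H v1); rewrite ltxx.
Qed.

Let cell_exists u : 0 <= u < 1 -> exists v, cell v u.
Proof.
move=> /andP[u0 u1].
have cumV : cum #|V| = 1.
  by rewrite -Q1 /cum; apply: eq_bigl => v; rewrite ltn_ord.
have ex : exists k, u < cum k by exists #|V|; rewrite cumV.
(* The cell containing [u] has as index the predecessor of the least [k] with [u < cum k]; that
   least [k] is positive because [cum 0 = 0]. *)
case: (ex_minnP ex) => -[|k] uk kmin.
  by move: uk; rewrite /cum big_pred0 // ltNge u0.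
have kV : (k < #|V|)%N by apply: kmin; rewrite cumV.
exists (enum_val (Ordinal kV)); rewrite /cell -cumS enum_valK /= uk andbT.
by rewrite leNgt; apply/negP => /kmin; rewrite ltnn.
Qed.

Let cell_ge0 v u : cell v u -> 0 <= u < 1.
Proof.
rewrite /cell => /andP[v1 v2]; apply/andP; split.
  by apply: le_trans v1; apply: sumr_ge0.
apply: (lt_le_trans v2); rewrite -cumS.
apply: (le_trans (cum_le _ #|V| _)); first exact: ltn_ord.
by rewrite -Q1 le_eqVlt; apply/orP; left; apply/eqP/eq_bigl => w; rewrite ltn_ord.
Qed.

Variable v0 : V.

(* [[0, 1[] is cut into consecutive cells of lengths [Q v]. Reading the cell of
[u] and then rescaling that cell to [[0, 1[] is a Bernoulli shift: under the
Lebesgue measure the successive cells are independent with law [Q]. *)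
Let digit (u : R) := odflt v0 [pick v | cell v u].

Let digitE v u : cell v u -> digit u = v.
Proof.
move=> vu; rewrite /digit; case: pickP => /= [w wu|/(_ v)]; last by rewrite vu.
exact: cell_uniq wu vu.
Qed.

Let shift (u : R) := (u - cum (enum_rank (digit u))) / Q (digit u).

Let digits i u := digit (iter i shift u).

Let cyl M (B : nat -> pred V) :=
  [set u : R | 0 <= u < 1 /\ forall i, (i < M)%N -> B i (digits i u)].

(** On the cell of [v], [shift] is the affine map onto [[0, 1[], so the later digits are the digits
    of the rescaled point. Letters with [Q v = 0] have empty cells. *)
Let cylS M B : cyl M.+1 B = \bigcup_(v in [set v | B 0%N v && (0 < Q v)])
  [set u | cyl M (fun i => B i.+1) ((u - cum (enum_rank v)) / Q v)].
Proof.
apply/seteqP; split => u /=.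
  move=> [u01 Bu]; have [v vu] := cell_exists u u01.
  have qv : 0 < Q v by move: vu => /andP[/le_lt_trans h /h]; rewrite ltrDl.
  exists v => /=; first by rewrite qv andbT -(digitE v u vu) (Bu 0%N).
  split=> [|i iM]; first by rewrite cellE.
  by have := Bu i.+1 iM; rewrite /digits iterSr {2}/shift (digitE v u vu).
move=> [v /andP[Bv qv] [vu Bu]].
rewrite cellE // in vu; split; first exact: cell_ge0 vu.
move=> [_|i]; first by rewrite /digits /= (digitE v u vu).
by rewrite ltnS => /Bu; rewrite /digits iterSr {3}/shift (digitE v u vu).
Qed.

(** Induction on [M] with [B] varying: [cylS] splits a cylinder into disjoint affine copies of a
    shorter one, scaled by the [Q v] of the first digit. *)
Let cyl_measure M B :
  measurable (cyl M B) /\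
  lebesgue_measure (cyl M B) = (\prod_(i < M) \sum_(v | B i v) Q v)%:E.
Proof.
elim: M B => [|M IH] B.
  have -> : cyl 0 B = `[0, 1[%classic.
    apply/seteqP; split => u /=; rewrite in_itv /=; first by case.
    by split.
  split; first exact: measurable_itv.
  by rewrite big_ord0 lebesgue_measure_itv /= lte_fin ltr01 oppr0 adde0.
have [mI lI] := IH (fun i => B i.+1).
pose F v := [set u : R | cyl M (fun i => B i.+1) ((u - cum (enum_rank v)) / Q v)].
pose D := [set v | B 0%N v && (0 < Q v)].
have FP v : D v -> measurable (F v) /\
    lebesgue_measure (F v) = ((Q v)%:E * lebesgue_measure (cyl M (fun i => B i.+1)))%E.
  by move=> /andP[_ qv]; exact: lebesgue_measure_affine.
have mF v : D v -> measurable (F v) by move=> /FP[].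
have -> : cyl M.+1 B = \bigcup_(v in D) F v by exact: cylS.
split.
  by apply: fin_bigcup_measurable.
have tF : trivIset D F.
  move=> v w /andP[_ qv] /andP[_ qw] [u [/= [vu _] [wu _]]].
  by apply: (cell_uniq u); rewrite -cellE.
have fD : finite_set D by exact: finite_finset.
rewrite measure_fin_bigcup //.
rewrite (eq_fsbigr (fun v => (Q v * \prod_(i < M) \sum_(v | B i.+1 v) Q v)%:E)); last first.
  move=> v /set_mem /FP[_ FE].
  by rewrite -[LHS]/(lebesgue_measure (F v)) FE lI EFinM.
rewrite -[D]/[set` [pred v | B 0%N v && (0 < Q v)]] -(@bigfs _ _ _ _ (index_enum V)) //=.
- rewrite sumEFin -mulr_suml big_ord_recl /=; congr (_ * _)%:E.
  (* Restoring the letters with [Q v = 0] does not change the sum. *)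
  rewrite [LHS]big_mkcond [RHS]big_mkcond /=; apply: eq_bigr => v _.
  rewrite /=; case: (B 0 v) => //=; case: ltP => // qv.
  by apply/eqP; rewrite eq_le qv Q0.
- exact: index_enum_uniq.
- by move=> v _; rewrite mem_index_enum.
Qed.

Lemma iid_digits_exist :
  exists (Pr : probability (measurableTypeR R) R) (X : nat -> measurableTypeR R -> V),
    (forall i v, measurable (X i @^-1` [set v])) /\
    forall M (B : nat -> pred V),
      Pr [set w | forall i, (i < M)%N -> B i (X i w)]
      = (\prod_(i < M) \sum_(v | B i v) Q v)%:E.
Proof.
have mI : measurable (`[0, 1[%classic : set (measurableTypeR R)) by exact: measurable_itv.
pose P0 := mrestr lebesgue_measure mI.
have P01 : P0 setT = 1%E.
  by rewrite /P0 /mrestr setTI lebesgue_measure_itv /= lte_fin ltr01 oppr0 adde0.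
pose Pr : probability (measurableTypeR R) R :=
  HB.pack P0 (Measure_isProbability.Build _ _ _ P0 P01).
(* The sample space is the whole line, with [Pr] carried by [[0, 1[]. The constant [v0] on the null
   complement makes each preimage a cylinder, joined to that complement when [v = v0]. *)
pose X i u := if 0 <= u < 1 then digits i u else v0.
exists Pr, X; split=> [i v|M B]; last first.
  have [_ <-] := cyl_measure M B.
  rewrite -[LHS]/(lebesgue_measure _); congr lebesgue_measure.
  apply/seteqP; split => u /=; rewrite in_itv /= /X.
    by move=> [Bu u01]; split=> // j jM; have := Bu j jM; rewrite u01.
  by move=> [u01 Bu]; split=> // j jM; rewrite u01; exact: Bu.
pose B j := if j == i then pred1 v else predT.
have -> : X i @^-1` [set v] =
    cyl i.+1 B `|` (if v == v0 then ~` `[0, 1[%classic else set0).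
  apply/seteqP; split => u /=; rewrite /X.
    case: ifPn => [u01 uv|u01 v0v].
      left; split=> // j _; rewrite /B; case: eqVneq => //= ->.
      by rewrite uv eqxx.
    by right; rewrite -v0v eqxx /= in_itv /=; apply/negP.
  case=> [[-> Bu]|]; first by apply/eqP; have := Bu i; rewrite /B eqxx; apply.
  by case: eqVneq => // -> /=; rewrite in_itv /=; case: ifPn.
apply: measurableU; first exact: (cyl_measure _ _).1.
by case: ifPn => // _; exact: measurableC.
Qed.

End RandomDigits.

(** * I.i.d. families over a countable index type *)

(** Stated with predicates [B j] instead of single values, one formula yields the common law, the
    independence and the probability of missing a given word. *)
Definition is_iid_family {R : realType} {d} {Omega : measurableType d}
    {I : eqType} {V : finType} (Pr : probability Omega R) (Q : V -> R)
    (X : I -> Omega -> V) : Prop :=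
  (forall i v, measurable (X i @^-1` [set v])) /\
  forall (J : seq I) (B : I -> pred V), uniq J ->
    Pr [set w | forall j, j \in J -> B j (X j w)]
    = (\prod_(j <- J) \sum_(v | B j v) Q v)%:E.

Lemma iid_family_exists (R : realType) (V : finType) (Q : V -> R)
    (I : countType) :
  (forall v, 0 <= Q v) -> \sum_v Q v = 1 ->
  exists (Pr : probability (measurableTypeR R) R) (X : I -> measurableTypeR R -> V),
    is_iid_family Pr Q X.
Proof.
move=> Q0 Q1.
have v0 : V.
  case: (pickP (@predT V)) => [v //|V0].
  by move: Q1; rewrite big_pred0 // => /eqP; rewrite eq_sym oner_eq0.
have [Pr [X [mX PX]]] := @iid_digits_exist R V Q Q0 Q1 v0.
exists Pr, (fun i => X (pickle i)); split=> [i v|J B uJ]; first exact: mX.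
(* A number that codes no element of [J] gets a trivial constraint, whose factor is the total mass
   1. *)
pose B' n : pred V := if pickle_inv n is Some j then
  [pred v | (j \in J) ==> B j v] else predT.
have [M JM] : exists M, forall j, j \in J -> (pickle j < M)%N.
  by exists (\max_(j <- J) pickle j).+1 => j jJ; rewrite ltnS leq_bigmax_seq.
have -> : [set w | forall j, j \in J -> B j (X (pickle j) w)] =
    [set w | forall n, (n < M)%N -> B' n (X n w)].
  apply/seteqP; split => w /= h.
    move=> n nM; rewrite /B'; have := pickle_invK (T := I) n.
    by case: (pickle_inv n) => //= j <-; apply/implyP; exact: h.
  move=> j jJ; have := h (pickle j) (JM j jJ).
  by rewrite /B' pickleK_inv /= jJ.
rewrite PX; congr EFin; rewrite -(big_mkord xpredT (fun n => \sum_(v | B' n v) Q v)).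
rewrite (bigID (mem (map pickle J))) /= mulrC big1 ?mul1r; last first.
  move=> n nJ; rewrite -[RHS]Q1; apply: eq_bigl => v; rewrite /B'.
  have := pickle_invK (T := I) n; case: (pickle_inv n) => //= j jn.
  by apply/implyP => jJ; move: nJ; rewrite -jn map_f.
rewrite -big_filter (perm_big (map pickle J)) /=; last first.
  apply: uniq_perm.
  - by rewrite filter_uniq // iota_uniq.
  - by rewrite map_inj_uniq //; exact: pcan_inj pickleK_inv.
  move=> n; rewrite mem_filter mem_index_iota /= andb_idr //.
  by move=> /mapP[j /JM jM ->].
rewrite big_map; apply: eq_big_seq => j jJ.
by apply: eq_bigl => v; rewrite /B' pickleK_inv /= jJ.
Qed.

(** * Independence of the agents *)

(** Uniqueness of finite measures on a pi-system: [E |-> Pr (E & H)] and [E |-> Pr E Pr H] agree on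
    [G], which contains the whole space. *)
Lemma sigma_independent_extend {R : realType} {d} {Omega : measurableType d}
    (Pr : probability Omega R) (G : set (set Omega)) (H : set Omega) :
  measurable H -> G `<=` measurable -> setI_closed G -> G setT ->
  (forall E, G E -> Pr (E `&` H) = (Pr E * Pr H)%E) ->
  forall E, <<s G >> E -> Pr (E `&` H) = (Pr E * Pr H)%E.
Proof.
move=> mH mG GI GT GH E sE.
have PH : Pr H = (fine (Pr H))%:E by rewrite fineK // fin_num_measure.
have h0 : 0 <= fine (Pr H) by rewrite fine_ge0.
pose m1 : {measure set Omega -> \bar R} := mrestr Pr mH.
pose m2 : {measure set Omega -> \bar R} := mscale (NngNum h0) Pr.
have m2E A : m2 A = (Pr A * Pr H)%E by rewrite PH muleC.
rewrite -m2E -[LHS]/(m1 E).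
apply: (g_sigma_algebra_measure_unique G mG (fun=> setT)) => //.
- by rewrite bigcup_const //; exists 0.
- by move=> A GA; rewrite m2E; exact: GH.
- move=> _; rewrite -[X in (X < _)%E]/(Pr (setT `&` H)) setTI PH; exact: ltry.
Qed.

Section AgentsIndependent.
Context {R : realType} {d : measure_display} {Omega : measurableType d}.
Context {A : countType} {V : finType} (Pr : probability Omega R) (Q : V -> R).
Context (X : A * nat -> Omega -> V) (iidX : is_iid_family Pr Q X).

Let g a k := X (a, k).

(** The single-guess events that generate [agent_sigma] need not be stable under intersection; these
    cylinders form a pi-system containing them. *)
Let cyl a : set (set Omega) :=
  [set E | exists m (B : nat -> pred V),
     E = [set w | forall k, (k < m)%N -> B k (g a k w)]].

Let preim_measurable (i : A * nat) (B : pred V) :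
  measurable [set w | B (X i w)].
Proof.
have -> : [set w | B (X i w)] = \bigcup_(v in [set` B]) (X i @^-1` [set v]).
  apply/seteqP; split => [w Bw|w [v /= Bv ->]] //.
  by exists (X i w).
by apply: fin_bigcup_measurable => // v _; exact: iidX.1.
Qed.

Let cyl_measurable a E : cyl a E -> measurable E.
Proof.
move=> [m [B ->]].
have -> : [set w | forall k, (k < m)%N -> B k (g a k w)] =
    \bigcap_(k in `I_m) [set w | B k (g a k w)].
  by apply/seteqP; split.
by apply: fin_bigcap_measurable => // k _; exact: preim_measurable.
Qed.

Let cylI a : setI_closed (cyl a).
Proof.
move=> _ _ [m [B ->]] [m' [B' ->]].
exists (maxn m m'), (fun k => [pred v | ((k < m)%N ==> B k v) && ((k < m')%N ==> B' k v)]).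
apply/seteqP; split => w /=.
  move=> [h h'] k _; apply/andP.
  by split; apply/implyP => ?; [exact: h|exact: h'].
move=> h; split=> k km; have := h k; rewrite leq_max km ?orbT /= => /(_ isT) /andP[].
  by [].
by [].
Qed.

Let cylT a : cyl a setT.
Proof. by exists 0%N, (fun=> predT); apply/seteqP; split. Qed.

Let cyl_sigma a E : agent_sigma (g a) E -> <<s (cyl a) >> E.
Proof.
apply: sub_sigma_algebra2 => _ [k [v ->]].
exists k.+1, (fun j => if j == k then pred1 v else predT).
apply/seteqP; split => w /=.
  by move=> gv j _; case: eqVneq => //= ->; rewrite gv.
by move=> /(_ k (ltnSn k)); rewrite eqxx => /eqP.
Qed.

(** The constraints of all agents are gathered in one duplicate-free list of pairs (agent, guess
    number); the i.i.d. formula on that list factors agent by agent. *)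
Let cyl_prod (F : seq A) (E : A -> set Omega) : uniq F ->
  (forall a, a \in F -> cyl a (E a)) ->
  Pr (\big[setI/setT]_(a <- F) E a) = (\prod_(a <- F) Pr (E a))%E.
Proof.
move=> uF cE.
have /choice [m /choice [B EB]] : forall a, exists m (B : nat -> pred V),
    a \in F -> E a = [set w | forall k, (k < m)%N -> B k (g a k w)].
  move=> a; case: (boolP (a \in F)) => [/cE [m [B EB]]|_]; first by exists m, B.
  by exists 0%N, (fun=> predT).
have setE (F' : seq A) : {subset F' <= F} -> \big[setI/setT]_(a <- F') E a =
    [set w | forall j, j \in [seq (a, k) | a <- F', k <- iota 0 (m a)] ->
       B j.1 j.2 (X j w)].
  move=> FF'; rewrite -bigcap_seq; apply/seteqP; split => w /=.
    move=> h _ /allpairsPdep[a [k [aF kI ->]]] /=.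
    have := h a aF; rewrite EB ?FF' //=; apply.
    by move: kI; rewrite mem_iota.
  move=> h a /= aF; rewrite EB ?FF' //= => k km.
  by apply: (h (a, k)); apply/allpairsPdep; exists a, k; rewrite mem_iota.
have prE (F' : seq A) : {subset F' <= F} -> uniq F' ->
    Pr (\big[setI/setT]_(a <- F') E a) =
    (\prod_(a <- F') \prod_(k <- iota 0 (m a)) \sum_(v | B a k v) Q v)%:E.
  move=> FF' uF'; rewrite setE // (iidX.2 _ (fun j => B j.1 j.2)); last first.
    apply: allpairs_uniq_dep => // [a _|[a k] [b l] _ _ /= [-> ->] //].
    exact: iota_uniq.
  by rewrite big_allpairs_dep.
rewrite prE // -prodEFin; apply: eq_big_seq => a aF.
have := prE [:: a]; rewrite !big_seq1 => -> // b.
by rewrite inE => /eqP ->.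
Qed.

(* By induction on [F1], the agents with a cylinder event are replaced one at a
time by agents with an arbitrary event of their sigma-algebra. *)
Lemma iid_agents_independent : agents_independent Pr g.
Proof.
suff H : forall (F1 F2 : seq A) E, uniq (F1 ++ F2) ->
    (forall a, a \in F1 -> agent_sigma (g a) (E a)) ->
    (forall a, a \in F2 -> cyl a (E a)) ->
    Pr (\big[setI/setT]_(a <- F1 ++ F2) E a) = (\prod_(a <- F1 ++ F2) Pr (E a))%E.
  move=> F E uF sE; have := H F [::] E; rewrite cats0; apply => //.
have mcyl a : cyl a `<=` measurable by move=> E; exact: cyl_measurable.
have msig a E : agent_sigma (g a) E -> measurable E.
  move=> /cyl_sigma; apply: smallest_sub => //; exact: sigma_algebra_measurable.
elim=> [|a F1 IH] F2 E; first by move=> uF _; exact: cyl_prod.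
rewrite cat_cons /= => /andP[aF uF] sE cE; rewrite !big_cons.
have aF1 b : b \in F1 ++ F2 -> b != a.
  by move=> bF; apply: contraNneq aF => <-.
have PH : Pr (\big[setI/setT]_(b <- F1 ++ F2) E b) = (\prod_(b <- F1 ++ F2) Pr (E b))%E.
  by apply: IH => // b bF; apply: sE; rewrite inE bF orbT.
rewrite -PH.
apply: (sigma_independent_extend Pr (cyl a)) => //.
- rewrite big_seq; apply: bigsetI_measurable => b.
  rewrite mem_cat => /orP[bF|/cE/cyl_measurable //].
  by apply: msig; apply: sE; rewrite inE bF orbT.
(* When [a] has a cylinder event [E'], it may join [F2], and the induction hypothesis applies to the
   modified events [E2]. *)
- move=> E' cE'; pose E2 b := if b == a then E' else E b.
  have E2E b : b \in F1 ++ F2 -> E2 b = E b by move=> /aF1 /negPf; rewrite /E2 => ->.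
  have := IH (a :: F2) E2.
  have pe : perm_eq (F1 ++ a :: F2) (a :: F1 ++ F2).
    by apply/permPl; exact: (perm_catCA F1 [:: a] F2).
  rewrite (perm_uniq pe) !(perm_big _ pe) /= aF uF !big_cons PH.
  have -> : E2 a = E' by rewrite /E2 eqxx.
  rewrite (eq_big_seq _ E2E) (eq_big_seq _ (fun b bF => congr1 Pr (E2E b bF))).
  move=> h; apply: h => // b.
  + move=> bF; rewrite E2E; first by apply: sE; rewrite inE bF orbT.
    by rewrite mem_cat bF.
  + rewrite inE /E2; case: eqVneq => [-> //|_ /= bF]; exact: cE.
- by apply: cyl_sigma; apply: sE; rewrite mem_head.
Qed.

End AgentsIndependent.

(** * The guessing time: measurability and lower bound for its moments *)

Section Guesswork.
Context {R : realType}.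

Lemma guessworkP {V : eqType} (x : V) (s : nat -> V) :
  (exists i, [/\ s i = x, guesswork x s = (i.+1%:R : R)%:E &
     forall j, (j < i)%N -> s j != x]) \/
  (guesswork x s = +oo%E :> \bar R /\ forall i, s i != x).
Proof.
have [ex|nex] := pselect (exists i, s i == x).
  left; case: (ex_minnP ex) => i /eqP six imin; exists i; split=> //.
    apply/eqP; rewrite eq_le; apply/andP; split.
      by apply: ereal_inf_lbound; exists i.
    apply: le_ereal_inf_tmp => _ [j /= sjx <-].
    by rewrite lee_fin ler_nat ltnS; apply: imin; rewrite sjx.
  by move=> j; apply: contraTneq => sjx; rewrite -leqNgt imin // sjx.
right; split; last by move=> i; apply/negP => six; apply: nex; exists i.
rewrite /guesswork (_ : [set i | s i = x] = set0); first by rewrite image_set0 ereal_inf0.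
by apply/seteqP; split => i //= /eqP six; apply: nex; exists i.
Qed.

(** The guessing time is a countable infimum of two-valued measurable functions: [i + 1] if guess
    [i] hits [x], infinity otherwise. *)
Lemma measurable_guesswork {d} {Omega : measurableType d} {V : eqType} (x : V)
    (s : nat -> Omega -> V) :
  (forall i v, measurable (s i @^-1` [set v])) ->
  measurable_fun setT (fun w => guesswork x (fun i => s i w) : \bar R).
Proof.
move=> ms.
have -> : (fun w => guesswork x (fun i => s i w) : \bar R) =
  (fun w => einfs (fun i => if s i w == x then ((i.+1%:R : R))%:E else +oo%E) 0).
  apply/funext => w; rewrite /einfs /=; apply/eqP; rewrite eq_le; apply/andP; split.
    apply: le_ereal_inf_tmp => _ [i _ <-]; case: eqVneq => [six|_]; last exact: leey.
    by apply: ereal_inf_lbound; exists i.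
  apply: le_ereal_inf_tmp => _ [i /= six <-].
  by apply: ereal_inf_lbound; exists i => //; rewrite six eqxx.
apply: measurable_fun_einfs => i.
apply: measurable_fun_ifT => //.
apply: (measurable_fun_bool true).
rewrite setTI (_ : _ @^-1` _ = s i @^-1` [set x]); first exact: ms.
by apply/seteqP; split => w /= /eqP.
Qed.

Lemma measurable_guesswork_power {d} {Omega : measurableType d} {V : eqType}
    (rho : R) (x : V) (s : nat -> Omega -> V) :
  (forall i v, measurable (s i @^-1` [set v])) ->
  measurable_fun setT
    (fun w => poweR (guesswork x (fun i => s i w) : \bar R) rho).
Proof.
by move=> ms; apply: (measurableT_comp (measurable_poweR rho));
  exact: measurable_guesswork.
Qed.

Lemma seq_moment_ge (V : finType) (rho : R) (P : V -> R) (s : nat -> V) :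
  0 < rho -> (forall x, 0 <= P x) -> 0 < \sum_x P x `^ (1 + rho)^-1 ->
  (((\sum_x P x `^ (1 + rho)^-1) `^ (1 + rho)
     * (2 + ln #|V|%:R) `^ (- rho))%:E
   <= \sum_x (P x)%:E * poweR (guesswork x s) rho)%E.
Proof.
move=> r0 P0 S0.
(* For a word never guessed, [fine +oo = 0] and [0^-1 = 0] give [h x = 0], the intended value of
   [1 / G x]. *)
pose h x : R := (fine (guesswork x s))^-1.
have V0 : (0 < #|V|)%N by apply/card_gt0P; exists (s 0%N).
apply: (@guess_moment_ge _ _ _ _ _ h) => //.
- by rewrite ltr_wpDr // ln_ge0 // ler1n.
- apply: (@sum_inv_position_le _ _ s) => x; rewrite /h.
  case: (guessworkP x s) => [[i [six -> _]]|[-> _]].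
    by right; exists i.
  by left; rewrite /= invr0.
- by move=> x; rewrite /h; case: (guessworkP x s) => [[i [_ -> _]]|[-> _]];
    rewrite /= invr_ge0.
- move=> x; rewrite /h; case: (guessworkP x s) => [[i [_ -> _]]|[-> _]].
    by left; rewrite /= invrK invr_gt0 ltr0n.
  by right; rewrite /= invr0 gt_eqF.
Qed.

(** [seq_moment_ge] bounds every realization; integrating it against a measure of mass 1 preserves
    the constant. *)
Lemma moment_ge {d} {Omega : measurableType d} (Pr : probability Omega R)
    (V : finType) (rho : R) (P : V -> R) (s : nat -> Omega -> V) :
  0 < rho -> (forall x, 0 <= P x) -> 0 < \sum_x P x `^ (1 + rho)^-1 ->
  (forall i v, measurable (s i @^-1` [set v])) ->
  (((\sum_x P x `^ (1 + rho)^-1) `^ (1 + rho)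
     * (2 + ln #|V|%:R) `^ (- rho))%:E
   <= \sum_x (P x)%:E *
        \int[Pr]_(w in setT) poweR (guesswork x (fun i => s i w)) rho)%E.
Proof.
move=> r0 P0 S0 ms; set K := (_ * _)%R.
have mG x : measurable_fun setT
    (fun w => poweR (guesswork x (fun i => s i w) : \bar R) rho).
  exact: measurable_guesswork_power.
rewrite (eq_bigr (fun x => \int[Pr]_w ((P x)%:E *
    poweR (guesswork x (fun i => s i w)) rho))%E); last first.
  by move=> x _; rewrite ge0_integralZl_EFin // => w _; exact: poweR_ge0.
rewrite -ge0_integral_sum //; first last.
- by move=> x w _; rewrite mule_ge0 ?lee_fin // poweR_ge0.
- by move=> x; apply: measurable_funeM.
have K0 : (0 : R) <= K by rewrite mulr_ge0 // powR_ge0.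
rewrite -[leLHS]mule1 -(@probability_setT _ _ _ Pr) -integral_cst //.
apply: ge0_le_integral => //.
- by apply: emeasurable_sum => x; apply: measurable_funeM.
- by move=> w _; exact: seq_moment_ge.
Qed.

(** * Moments of a geometric guessing time *)

Lemma nneseries_le_geometric (u : nat -> \bar R) (a r : R) :
  0 <= a -> 0 <= r < 1 -> (forall j, (0 <= u j <= (a * r ^+ j)%:E)%E) ->
  (\sum_(j <oo) u j <= (a / (1 - r))%:E)%E.
Proof.
move=> a0 /andP[r0 r1] hu.
have u0 j : (0 <= u j)%E by case/andP: (hu j).
have r1' : 0 < 1 - r by rewrite subr_gt0.
apply: lime_le; first by apply: is_cvg_nneseries => n _ _.
apply: nearW => n; apply: (@le_trans _ _ (\sum_(0 <= j < n) (a * r ^+ j)%:E)%E).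
  by apply: lee_sum => j _; case/andP: (hu j).
rewrite sumEFin lee_fin -mulr_sumr ler_wpM2l // -[leRHS]mul1r ler_pdivlMr //.
have -> : (\sum_(0 <= j < n) r ^+ j) * (1 - r) = 1 - r ^+ n.
  elim: n => [|n IH]; first by rewrite big_nil mul0r expr0 subrr.
  by rewrite big_nat_recr //= mulrDl IH exprSr; ring.
by rewrite gerBl exprn_ge0.
Qed.

Definition decay : R := expR (- 2^-1).

Definition growth (rho : R) : R := expR (2^-1 + rho * ln (2 * rho)).

Lemma decay01 : 0 <= decay < 1.
Proof. by rewrite /decay expR_ge0 /= expR_lt1 oppr_lt0 invr_gt0. Qed.

(** Half of the exponential decay absorbs the polynomial factor: [ln t < t] at [t = (j+1) / (2 rho)]
    gives [rho ln (j+1) <= (j+1)/2 + rho ln (2 rho)]. *)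
Lemma powR_exp_decay (rho : R) (j : nat) : 0 < rho ->
  j.+1%:R `^ rho * expR (- 1) ^+ j <= growth rho * decay ^+ j.
Proof.
move=> r0; rewrite /growth /decay -!expRM_natl /powR gt_eqF ?ltr0n // -!expRD ler_expR.
have j0 : (0 : R) < j.+1%:R by rewrite ltr0n.
have tr0 : 0 < 2 * rho by rewrite mulr_gt0.
have H : ln (j.+1%:R : R) <= j.+1%:R / (2 * rho) + ln (2 * rho).
  have := @ln_sublinear R (j.+1%:R / (2 * rho)).
  by rewrite divr_gt0 // ln_div ?posrE // => /(_ isT) /ltW; rewrite lerBlDr.
have : rho * ln (j.+1%:R : R) <= rho * (j.+1%:R / (2 * rho) + ln (2 * rho)).
  by rewrite ler_pM2l.
have -> : rho * (j.+1%:R / (2 * rho) + ln (2 * rho)) = j%:R / 2 + 2^-1 + rho * ln (2 * rho).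
  rewrite -[j.+1%:R]natr1; field; lra.
lra.
Qed.

(** [2 ^ rho] pays for rounding the block length up to at most [2 / q]; the rest is the sum of the
    geometric series over blocks. *)
Definition guess_constant (rho : R) : R := 2 `^ rho * growth rho / (1 - decay).

Lemma guess_constant_ge0 rho : 0 <= guess_constant rho.
Proof.
rewrite /guess_constant divr_ge0 ?mulr_ge0 ?powR_ge0 ?expR_ge0 // subr_ge0 ltW //.
by case/andP: decay01.
Qed.

(* Guesses are grouped into blocks of length [K], about [1 / q]: each block misses
[x] with probability at most [1 / e], so [G ^ rho] is dominated by the sum over
[j] of [(j + 1)^rho K^rho 1_{no hit in the first j blocks}]. This also holds when
[x] is never guessed, both sides being then infinite. *)
Lemma geometric_guess_moment_le {d} {Omega : measurableType d}
    (Pr : probability Omega R) {V : eqType} (rho q : R) (x : V)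
    (s : nat -> Omega -> V) :
  0 < rho -> 0 < q <= 1 ->
  (forall i v, measurable (s i @^-1` [set v])) ->
  (forall m, Pr [set w | forall i, (i < m)%N -> s i w != x] = ((1 - q) ^+ m)%:E) ->
  (\int[Pr]_(w in setT) poweR (guesswork x (fun i => s i w)) rho
   <= (guess_constant rho * q `^ (- rho))%:E)%E.
Proof.
move=> r0 /andP[q0 q1] ms Ps.
pose E m := [set w | forall i, (i < m)%N -> s i w != x].
have mE m : measurable (E m).
  have -> : E m = \bigcap_(i in `I_m) ~` (s i @^-1` [set x]).
    apply/seteqP; split => w /= h i im; first by apply/eqP; exact: h.
    by apply/eqP; exact: h.
  by apply: fin_bigcap_measurable => // i _; exact: measurableC.
(* As [q <= 1], this gives [1/q <= K <= 2/q]. *)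
pose K := (Num.truncn q^-1).+1.
have qi1 : 1 <= q^-1 by rewrite invf_ge1.
have qi0 : 0 <= q^-1 by exact: le_trans qi1.
have Kge : q^-1 <= K%:R by apply: ltW; exact: truncnS_gt.
have Kle : K%:R <= 2 * q^-1.
  have := truncn_le q^-1; rewrite qi0 /K -natr1; lra.
have K0 : (0 : R) < K%:R by rewrite ltr0n.
pose c j : R := (j.+1 * K)%:R `^ rho.
pose u j w := ((c j)%:E * (\1_(E (j * K)%N) w)%:E)%E.
have u0 j w : (0 <= u j w)%E by rewrite mule_ge0 ?lee_fin ?powR_ge0.
have mu j : measurable_fun setT (u j).
  by apply: measurable_funeM; apply/measurable_EFinP; exact: measurable_indic.
have uE j w : E (j * K)%N w -> u j w = (c j)%:E.
  by move=> Ew; rewrite /u indicE mem_set // mule1.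
have u_le j w : (u j w <= \sum_(i <oo) u i w)%E.
  apply: (@le_trans _ _ (\sum_(0 <= i < j.+1) u i w)%E).
    by rewrite big_nat_recr //= leeDr // sume_ge0.
  by apply: nneseries_lim_ge.
have c_ge j (y : R) : 0 <= y -> y <= (j.+1 * K)%:R -> y `^ rho <= c j.
  by move=> y0 yj; rewrite /c ge0_ler_powR // ?nnegrE // ltW.
apply: (@le_trans _ _ (\int[Pr]_w \sum_(j <oo) u j w)%E).
  apply: ge0_le_integral => //.
  - by move=> w _; exact: poweR_ge0.
  - exact: measurable_guesswork_power.
  - exact: ge0_emeasurable_sum.
  move=> w _; case: (guessworkP x (fun i => s i w)) => [[i [_ -> imin]]|[-> never]].
    (* The term of the block containing the first hit suffices: no hit precedes that block, and
       [i + 1 <= (i / K + 1) K]. *)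
    rewrite poweR_EFin; apply: le_trans (u_le (i %/ K)%N w).
    rewrite uE; first by rewrite lee_fin c_ge // ler_nat ltn_ceil.
    by move=> k ki; apply: imin; apply: leq_trans ki _; exact: leq_trunc_div.
  (* Without any hit every term equals [c j], and [c j >= M] as soon as [j + 1] exceeds
     [M ^ (1/rho)]. *)
  rewrite poweRyr ?gt_eqF // leye_eq; apply/eqP/eqyP => M M0.
  pose j := Num.truncn (M `^ rho^-1).
  apply: le_trans (u_le j w); rewrite uE // lee_fin.
  have {1}-> : M = (M `^ rho^-1) `^ rho by rewrite -powRrM mulVf ?gt_eqF // powRr1 // ltW.
  apply: c_ge; first exact: powR_ge0.
  apply: (@le_trans _ _ j.+1%:R); first by apply: ltW; exact: truncnS_gt.
  by rewrite ler_nat leq_pmulr.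
rewrite integral_nneseries //.
pose a := K%:R `^ rho * growth rho.
have a0 : 0 <= a by rewrite mulr_ge0 ?powR_ge0 ?expR_ge0.
apply: (@le_trans _ _ (a / (1 - decay))%:E).
  apply: nneseries_le_geometric => // [|j]; first exact: decay01.
  apply/andP; split; first exact: integral_ge0.
  rewrite ge0_integralZl_EFin ?powR_ge0 //; last first.
    by apply/measurable_EFinP; exact: measurable_indic.
  rewrite integral_indic // setIT -[X in (_ * X)%E]/(Pr (E (j * K)%N)) Ps -EFinM lee_fin.
  have -> : c j = K%:R `^ rho * j.+1%:R `^ rho.
    by rewrite /c natrM mulrC powRM.
  rewrite /a -!mulrA ler_pM2l ?powR_gt0 //.
  apply: le_trans (powR_exp_decay _ j r0); rewrite ler_pM2l ?powR_gt0 ?ltr0n //.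
  rewrite mulnC exprM lerXn2r ?nnegrE ?expR_ge0 ?exprn_ge0 ?subr_ge0 //.
  (* A block misses with probability [(1 - q)^K <= exp (- q K) <= exp (- 1)], since [q K >= 1]. *)
  apply: (@le_trans _ _ (expR (- q) ^+ K)).
    by rewrite lerXn2r ?nnegrE ?expR_ge0 ?subr_ge0 // expR_ge1Dx.
  rewrite -expRM_natl ler_expR mulrN lerN2.
  by rewrite -ler_pdivrMr // mul1r.
rewrite lee_fin /guess_constant /a.
have le2 : K%:R `^ rho <= 2 `^ rho * q `^ (- rho).
  rewrite powR_opp ?(ltW q0) // -powRM ?invr_ge0 ?(ltW q0) //.
  by rewrite ge0_ler_powR ?nnegrE ?(ltW r0) ?mulr_ge0 // ltW.
rewrite -mulrA -[X in _ <= X * _]mulrA [leRHS]mulrAC ler_wpM2r //.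
by rewrite divr_ge0 ?expR_ge0 // subr_ge0 ltW //; case/andP: decay01.
Qed.

End Guesswork.

(** * Interleavings and product laws *)

(** The pairs are countable, and infinite because they project onto [nat]. This gives the supremum
    over interleavings a member to be bounded below by. *)
Lemma bijective_nat_prod (A : countType) (a0 : A) :
  exists pi : nat -> A * nat, bijective pi.
Proof.
have infA : infinite_set [set: A * nat].
  move=> fin; apply: infinite_nat.
  apply: (@sub_finite_set _ _ (snd @` [set: A * nat])); last exact: finite_image.
  by move=> n _; exists (a0, n).
have /card_set_bijP [f] := @eq_card_nat _ [set: A * nat] (countableP _) infA.
by rewrite setTT_bijective => -[g fK gK]; exists g; exact: Bijective gK fK.
Qed.

Lemma powR_prod (R : realType) (I : finType) (F : I -> R) (a : R) :
  (forall i, 0 <= F i) -> (\prod_i F i) `^ a = \prod_i F i `^ a.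
Proof.
move=> F0; suff [] : 0 <= \prod_i F i /\ (\prod_i F i) `^ a = \prod_i F i `^ a by [].
elim/big_rec2: _ => [|i y1 y2 _ [y20 <-]]; first by rewrite powR1.
by rewrite mulr_ge0 // powRM.
Qed.

Lemma sum_prod_pmf_powR (R : realType) (T : finType) (P : T -> R) (a : R) (n : nat) :
  (forall x, 0 <= P x) ->
  \sum_x prod_pmf P n x `^ a = (\sum_x P x `^ a) ^+ n.
Proof.
move=> P0; rewrite -[n in RHS]card_ord -prodr_const bigA_distr_bigA /=.
by apply: eq_bigr => x _; rewrite powR_prod.
Qed.

(** * The tilted law and its guessing cost *)

Section Tilted.
Context {R : realType} {V : finType} (P : V -> R) (rho : R).
Hypotheses (P0 : forall x, 0 <= P x) (r0 : 0 < rho).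
Let S := \sum_x P x `^ (1 + rho)^-1.
Hypothesis S0 : 0 < S.

Definition tilted_pmf (x : V) : R := P x `^ (1 + rho)^-1 / S.

Lemma tilted_pmf_ge0 x : 0 <= tilted_pmf x.
Proof. by rewrite divr_ge0 ?powR_ge0 // ltW. Qed.

Lemma sum_tilted_pmf : \sum_x tilted_pmf x = 1.
Proof. by rewrite -mulr_suml divff // gt_eqF. Qed.

(** The exponents of [P x] combine by [1 - rho/(1 + rho) = 1/(1 + rho)]. *)
Lemma tilted_cost x : 0 < P x ->
  P x * tilted_pmf x `^ (- rho) = S `^ rho * P x `^ (1 + rho)^-1.
Proof.
move=> Px.
have r1 : 1 + rho != 0 by rewrite gt_eqF // addr_gt0.
rewrite /tilted_pmf powRM ?powR_ge0 ?invr_ge0 ?(ltW S0) //.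
rewrite -(powR_inv1 (ltW S0)) -!powRrM mulN1r opprK mulrA mulrC; congr (_ * _).
rewrite -{1}(powRr1 (ltW Px)) -powRD; last by rewrite (gt_eqF Px) implybT.
by congr (_ `^ _); field.
Qed.

Lemma sum_tilted_cost : \sum_x S `^ rho * P x `^ (1 + rho)^-1 = S `^ (1 + rho).
Proof.
rewrite -mulr_sumr -/S mulrC powRD; last by rewrite (gt_eqF S0) implybT.
by rewrite powRr1 // ltW.
Qed.

(** As [pi] is injective, the first [m] guesses are [m] different members of the family, and all
    miss [x] with probability [(1 - tilted_pmf x)^m] whatever [pi] is. *)
Lemma iid_moment_le {d} {Omega : measurableType d} (Pr : probability Omega R)
    (I : eqType) (X : I -> Omega -> V) (pi : nat -> I) :
  is_iid_family Pr tilted_pmf X -> injective pi ->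
  (\sum_x (P x)%:E *
      \int[Pr]_(w in setT) poweR (guesswork x (fun i => X (pi i) w)) rho
   <= (guess_constant rho * S `^ (1 + rho))%:E)%E.
Proof.
move=> [mX iidX] pi_inj.
rewrite -sum_tilted_cost mulr_sumr -sumEFin; apply: lee_sum => x _.
have C0 := guess_constant_ge0 rho.
(* A null word may have an infinite moment; its contribution is still 0 by the convention
   [0 * +oo = 0]. *)
have [->|Pn0] := eqVneq (P x) 0.
  by rewrite mul0e lee_fin mulr_ge0 // mulr_ge0 // powR_ge0.
have Px : 0 < P x by rewrite lt_neqAle eq_sym Pn0 P0.
have q0 : 0 < tilted_pmf x by rewrite divr_gt0 // powR_gt0.
have sum_neq : \sum_(v | v != x) tilted_pmf v = 1 - tilted_pmf x.
  by rewrite -sum_tilted_pmf [in RHS](bigD1 x) //= addrC addrK.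
have q1 : tilted_pmf x <= 1.
  by rewrite -subr_ge0 -sum_neq sumr_ge0 // => v _; exact: tilted_pmf_ge0.
rewrite -tilted_cost // mulrCA EFinM lee_wpmul2l ?lee_fin //.
apply: geometric_guess_moment_le => // [|m]; first by rewrite q0.
pose J := [seq pi i | i <- iota 0 m].
have -> : [set w | forall i, (i < m)%N -> X (pi i) w != x] =
    [set w | forall j, j \in J -> predC1 x (X j w)].
  apply/seteqP; split => w /= h.
    by move=> _ /mapP[i + ->]; rewrite mem_iota => /h.
  by move=> i im; apply: h; rewrite map_f // mem_iota.
rewrite (iidX J (fun=> predC1 x)) ?map_inj_uniq ?iota_uniq // sum_neq.
by rewrite big_const_seq count_predT size_map size_iota iter_mulr mulr1.
Qed.

End Tilted.

(** * Matching bounds for the optimal strategy and the optimal list *)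

Section Bounds.
Context {R : realType} {T : finType} (P : T -> R) (rho : R).
Hypotheses (pmfP : is_pmf P) (r0 : 0 < rho).
Let s := \sum_x P x `^ (1 + rho)^-1.
Let c : R := ln #|T|%:R.
Let lower n := (s ^+ n) `^ (1 + rho) * (2 + n%:R * c) `^ (- rho).
Let upper n := (s ^+ n) `^ (1 + rho).

Let P0 x : 0 <= P x. Proof. exact: pmfP.1. Qed.

Lemma pmf_powR_sum_gt0 : 0 < s.
Proof.
rewrite lt_neqAle eq_sym sumr_ge0 ?andbT => [|x _]; last exact: powR_ge0.
apply/negP; rewrite psumr_eq0 => [/allP s0|x _]; last exact: powR_ge0.
have := pmfP.2; rewrite big1 => [/eqP|x _]; first by rewrite eq_sym oner_eq0.
by have := s0 x (mem_index_enum x); rewrite powR_eq0 => /andP[/eqP].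
Qed.

Lemma pmf_card_gt0 : (0 < #|T|)%N.
Proof.
rewrite lt0n; apply/eqP => T0; have := pmfP.2.
rewrite big1 => [/eqP|x _]; first by rewrite eq_sym oner_eq0.
by have := card0_eq T0 x; rewrite inE.
Qed.

Let prod_pmf_ge0 n x : 0 <= prod_pmf P n x.
Proof. by apply: prodr_ge0 => i _. Qed.

Let sumE n : \sum_x prod_pmf P n x `^ (1 + rho)^-1 = s ^+ n.
Proof. by rewrite sum_prod_pmf_powR. Qed.

Let sum_gt0 n : 0 < \sum_x prod_pmf P n x `^ (1 + rho)^-1.
Proof. by rewrite sumE exprn_gt0 // pmf_powR_sum_gt0. Qed.

Let ln_card n : ln (#|{ffun 'I_n -> T}|%:R : R) = n%:R * c.
Proof.
by rewrite card_ffun card_ord natrX lnXn ?ltr0n ?pmf_card_gt0 // -[ln _ *+ n]mulr_natl.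
Qed.

Lemma optimal_value_bounds (A : countType) (a0 : A) (n : nat) :
  ((lower n)%:E <= optimal_value A P rho n
     <= (guess_constant rho * upper n)%:E)%E.
Proof.
apply/andP; split.
  apply: le_ereal_inf_tmp => _ [d [W [Pr [g [mg [_ ->]]]]]].
  (* The lower bound holds for every interleaving, so a single one bounds the supremum from
     below. *)
  have [pi bpi] := bijective_nat_prod A a0.
  apply: (@le_trans _ _ (strategy_moment P rho n Pr g pi)); last first.
    by apply: ereal_sup_ubound; exists pi.
  rewrite /lower -sumE -ln_card.
  by apply: moment_ge => // i v; exact: mg.
have q0 := tilted_pmf_ge0 (prod_pmf P n) rho (sum_gt0 n).
have q1 := sum_tilted_pmf (prod_pmf P n) rho (sum_gt0 n).
(* One i.i.d. family indexed by (agent, guess number) serves all agents, with the tilted law of the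
   product distribution. *)
have [Pr [X iidX]] := iid_family_exists R _ _ (A * nat)%type q0 q1.
apply: (@le_trans _ _ (ereal_sup [set strategy_moment P rho n Pr
    (fun a k => X (a, k)) pi | pi in [set pi : nat -> A * nat | bijective pi]])).
  apply: ereal_inf_lbound; exists _, (measurableTypeR R), Pr, (fun a k => X (a, k)).
  split; first by move=> a k v; exact: iidX.1.
  by split=> //; exact: iid_agents_independent iidX.
apply: ge_ereal_sup => _ [pi /bij_inj pi_inj <-].
rewrite /upper -sumE.
have := iid_moment_le (prod_pmf P n) rho (prod_pmf_ge0 n) r0 (sum_gt0 n) Pr _ X pi iidX pi_inj.
rewrite /strategy_moment; congr (_ <= _)%E; apply: eq_bigr => x _.
congr (_ * _)%E; apply: eq_integral => w _.
by congr (poweR (guesswork _ _) _); apply/funext => i; case: (pi i).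
Qed.

Section Ranking.
Variables (n : nat) (r : {ffun 'I_n -> T} -> nat).
Hypothesis rP : is_sorted_ranking P n r.

Lemma opt_moment_ge : lower n <= opt_moment P rho n r.
Proof.
have [rI _] := rP.
have [x0 _] : exists x0 : {ffun 'I_n -> T}, true.
  by case/card_gt0P: pmf_card_gt0 => t _; exists [ffun=> t].
(* The list is read as a guessing sequence. The filler [x0] at ranks carried by no word is harmless,
   as each word only needs one valid position. *)
pose f i := odflt x0 [pick x | r x == i].
have fr x : f (r x) = x.
  rewrite /f; case: pickP => [y /eqP /rI //|/(_ x)]; by rewrite eqxx.
rewrite -lee_fin /lower -sumE -ln_card /opt_moment -sumEFin.
rewrite [leRHS](eq_bigr (fun x =>
  (prod_pmf P n x)%:E * ((r x).+1%:R `^ rho)%:E)%E) => [|x _]; last by rewrite EFinM.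
apply: (@guess_moment_ge _ _ _ _ _ (fun x => (r x).+1%:R^-1)) => //.
- by rewrite ltr_wpDr // ln_ge0 // ler1n; apply/card_gt0P; exists x0.
- by apply: (@sum_inv_position_le _ _ f) => x; right; exists (r x).
- by move=> x; left; rewrite invrK invr_gt0 ltr0n.
Qed.

(* Every [y] ranked no later than [x] satisfies [(P y / P x) ^ alpha >= 1]. *)
Let rank_le x : 0 < prod_pmf P n x ->
  (r x).+1%:R <= s ^+ n / prod_pmf P n x `^ (1 + rho)^-1.
Proof.
move=> Px; have [rI [rb rs]] := rP.
have Pa : 0 < prod_pmf P n x `^ (1 + rho)^-1 by exact: powR_gt0.
pose N := #|{ffun 'I_n -> T}|.
have rN y : (r y < N)%N by rewrite /N card_ffun card_ord.
(* An injection of the [N] words into ['I_N] is a bijection, so exactly [r x + 1] words have rank at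
   most [r x]. *)
have -> : (r x).+1 = #|[pred y | (r y <= r x)%N]|.
  pose phi y : 'I_N := Ordinal (rN y).
  have phiI : injective phi by move=> y z /(congr1 val) /rI.
  have -> : #|[pred y | (r y <= r x)%N]| =
      #|phi @^-1: [pred i : 'I_N | (i <= r x)%N]|.
    by apply: eq_card => y; rewrite !inE.
  rewrite on_card_preimset; last first.
    by apply/onW_bij/(inj_card_bij phiI); rewrite card_ord.
  rewrite -sum1_card (eq_bigl (fun i : 'I_N => (i < (r x).+1)%N)) //.
  by rewrite (big_ord_narrow (rN x)) sum1_card card_ord.
rewrite ler_pdivlMr // -sumE mulr_natl -sumr_const.
apply: (@le_trans _ _ (\sum_(y in [pred y | (r y <= r x)%N])
   prod_pmf P n y `^ (1 + rho)^-1)).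
  apply: ler_sum => y; rewrite inE => ryx.
  apply: ge0_ler_powR; rewrite ?nnegrE ?invr_ge0 ?addr_ge0 ?(ltW r0) ?prod_pmf_ge0 //.
  by rewrite leNgt; apply/negP => /rs; rewrite ltnNge ryx.
rewrite [leRHS](bigID (mem [pred y | (r y <= r x)%N])) /= lerDl sumr_ge0 // => y _.
exact: powR_ge0.
Qed.

(** By [rank_le], [r x + 1] is at most the inverse of the tilted probability of [x], so the sum is
    dominated termwise by [sum_tilted_cost]. *)
Lemma opt_moment_le : opt_moment P rho n r <= upper n.
Proof.
rewrite /upper -sumE -(sum_tilted_cost _ _ (sum_gt0 n)); apply: ler_sum => x _.
have [->|Pn0] := eqVneq (prod_pmf P n x) 0.
  by rewrite mul0r mulr_ge0 ?powR_ge0.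
have Px : 0 < prod_pmf P n x by rewrite lt_neqAle eq_sym Pn0 prod_pmf_ge0.
rewrite -tilted_cost // ler_pM2l // /tilted_pmf sumE powR_opp; last first.
  by rewrite divr_ge0 ?powR_ge0 // exprn_ge0 // ltW // pmf_powR_sum_gt0.
rewrite invf_div ge0_ler_powR ?nnegrE ?(ltW r0) //; last exact: rank_le.
exact: le_trans (ler0n _ _) (rank_le _ Px).
Qed.

End Ranking.

(** The prefactor of the entropy is [(1 + rho) / rho], because [1 - 1/(1 + rho) = rho/(1 + rho)]. *)
Lemma renyi_exponent : rho * renyi_entropy (1 + rho)^-1 P = (1 + rho) * ln s.
Proof.
rewrite /renyi_entropy -/s; field.
by rewrite addrC addrK !gt_eqF // addr_gt0.
Qed.

End Bounds.

Theorem theorem1 (R : realType) (T : finType) (A : countType) (a0 : A)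
    (P : T -> R) (rho : R) :
  is_pmf P -> 0 < rho ->
  ((exists N : nat, forall n : nat, (N <= n)%N ->
       optimal_value A P rho n \is a fin_num) /\
   (fun n : nat => (n%:R)^-1 * ln (fine (optimal_value A P rho n)))
      @ \oo --> rho * renyi_entropy (1 + rho)^-1 P) /\
  (forall r : forall n : nat, {ffun 'I_n -> T} -> nat,
     (forall n, is_sorted_ranking P n (r n)) ->
     (fun n : nat => (n%:R)^-1 * ln (opt_moment P rho n (r n)))
       @ \oo --> rho * renyi_entropy (1 + rho)^-1 P).
Proof.
move=> pmfP r0.
have s0 := pmf_powR_sum_gt0 P rho pmfP.
have c0 : 0 <= ln (#|T|%:R : R) by rewrite ln_ge0 // ler1n (pmf_card_gt0 P).
have fin_opt n : optimal_value A P rho n \is a fin_num.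
  have /andP[l u] := optimal_value_bounds P rho pmfP r0 A a0 n.
  by rewrite fin_numElt (lt_le_trans _ l) ?ltNyr // (le_lt_trans u) // ltry.
rewrite (renyi_exponent P rho r0); split; first split.
- by exists 0.
- apply: (exponent_cvg R rho _ _ (guess_constant rho) _ r0 s0 c0) => n.
  by rewrite -!lee_fin fineK //; exact: optimal_value_bounds.
move=> r rP; apply: (exponent_cvg R rho _ _ 1 _ r0 s0 c0) => n.
by rewrite mul1r opt_moment_ge // opt_moment_le.
Qed.
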